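(* For every $n \in \mathbb{N}$ there exists a variety $\mathsf{V}$ of Heyting algebras such that the free algebra of $\mathsf{V}$ on $n$ generators is finite, while the free algebra of $\mathsf{V}$ on $n+1$ generators is infinite.
   Context: A Heyting algebra is a structure $\langle A;\land,\lor,\to,0,1\rangle$ such that $\langle A;\land,\lor,0,1\rangle$ is a bounded distributive lattice and $a\land b\le c \iff a\le b\to c$ for all $a,b,c\in A$. A variety is a class of algebras closed under homomorphic images, subalgebras and products (equivalently, an equational class). Here $\mathbb{N}=\{0,1,2,\dots\}$. *)

(* Defs.v *)
From Stdlib Require Import List Fin.
Import ListNotations.

Record HeytingAlgebra := {
  carrier :> Type;
  hmeet : carrier -> carrier -> carrier;
  hjoin : carrier -> carrier -> carrier;
  himp  : carrier -> carrier -> carrier;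
  hbot  : carrier;
  htop  : carrier;
  meetA : forall a b c, hmeet a (hmeet b c) = hmeet (hmeet a b) c;
  joinA : forall a b c, hjoin a (hjoin b c) = hjoin (hjoin a b) c;
  meetC : forall a b, hmeet a b = hmeet b a;
  joinC : forall a b, hjoin a b = hjoin b a;
  meet_absorb : forall a b, hmeet a (hjoin a b) = a;
  join_absorb : forall a b, hjoin a (hmeet a b) = a;
  meet_distr : forall a b c, hmeet a (hjoin b c) = hjoin (hmeet a b) (hmeet a c);
  join_bot : forall a, hjoin a hbot = a;
  meet_top : forall a, hmeet a htop = a;
  residuation : forall a b c,
    hmeet (hmeet a b) c = hmeet a b <-> hmeet a (himp b c) = a
}.

Inductive term (X : Type) : Type :=
| tvar : X -> term X
| tbot : term X
| ttop : term X
| tmeet : term X -> term X -> term X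
| tjoin : term X -> term X -> term X
| timp : term X -> term X -> term X.

Arguments tvar {X} _.
Arguments tbot {X}.
Arguments ttop {X}.
Arguments tmeet {X} _ _.
Arguments tjoin {X} _ _.
Arguments timp {X} _ _.

Fixpoint eval {X : Type} (A : HeytingAlgebra) (v : X -> A) (t : term X) : A :=
  match t with
  | tvar x => v x
  | tbot => hbot A
  | ttop => htop A
  | tmeet s u => hmeet A (eval A v s) (eval A v u)
  | tjoin s u => hjoin A (eval A v s) (eval A v u)
  | timp s u => himp A (eval A v s) (eval A v u)
  end.

Definition equation := (term nat * term nat)%type.

(** A variety of Heyting algebras, given as an equational class: the class
    of all Heyting algebras satisfying every equation of the set E. *)
Definition variety := equation -> Prop.

Definition in_variety (E : variety) (A : HeytingAlgebra) : Prop :=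
  forall e, E e -> forall v : nat -> A, eval A v (fst e) = eval A v (snd e).

(** Generators of the free algebra on n generators: Fin.t n.
    Two n-ary terms are identified in the free algebra F_V(n) iff the
    equation between them holds in every member of V. *)
Definition free_equiv (E : variety) (n : nat) (t s : term (Fin.t n)) : Prop :=
  forall (A : HeytingAlgebra), in_variety E A ->
    forall v : Fin.t n -> A, eval A v t = eval A v s.

(** F_V(n) = term(Fin.t n) / free_equiv E n is finite iff finitely many
    terms represent all classes. *)
Definition free_algebra_finite (E : variety) (n : nat) : Prop :=
  exists L : list (term (Fin.t n)),
    forall t : term (Fin.t n), exists s, In s L /\ free_equiv E n t s.

(* Main.v *)
(* Fix a finite set I of columns with 2^n < |I| <= 2^(n+1) and let P be the poset
   of the levels {k} x I, k = 0 on top, in which a point sees every level at least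
   two above its own and, on the level directly above, every column but its own,
   except that in one special column s k.+1 it sees the whole level k.  The
   variety is generated by the upsets of P.
   With n + 1 upsets all points of level 0 can be told apart; then successively
   all points of P are definable and there are infinitely many term functions.
   With n upsets, each of them is neither full nor empty on at most two
   consecutive levels, and the pigeonhole principle yields two columns that are
   never told apart.  On a long stretch of levels of constant colour, the class
   of these two columns absorbs the special column of each level, hence, as s
   runs through I, all columns; from then on the levels of the stretch are
   bisimilar.  So every n-coloured P has a bisimulation quotient of size bounded
   in terms of n. *)
From Stdlib Require Fin List FinFun.
From mathcomp Require Import all_boot.
From mathcomp Require Import boolp zify.
Require Import Defs.

Set Implicit Arguments.
Unset Strict Implicit.
Unset Printing Implicit Defensive.

(** * Terms and equational classes *)

Fixpoint rename (X Y : Type) (f : X -> Y) (t : term X) : term Y :=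
  match t with
  | tvar x => tvar (f x)
  | tbot => tbot
  | ttop => ttop
  | tmeet s u => tmeet (rename f s) (rename f u)
  | tjoin s u => tjoin (rename f s) (rename f u)
  | timp s u => timp (rename f s) (rename f u)
  end.

Lemma eval_rename X Y (f : X -> Y) (A : HeytingAlgebra) (v : Y -> A) w t :
  (forall x, v (f x) = w x) -> eval A v (rename f t) = eval A w t.
Proof. by move=> vf; elim: t => //= s -> u ->. Qed.

Definition ord_of_fin n (x : Fin.t n) : 'I_n :=
  Ordinal (introT ltP (proj2_sig (Fin.to_nat x))).

Definition fin_of_ord n (i : 'I_n) : Fin.t n := Fin.of_nat_lt (elimT ltP (ltn_ord i)).

Lemma ord_of_finK n : cancel (@ord_of_fin n) (@fin_of_ord n).
Proof.
move=> x; rewrite -[RHS]Fin.of_nat_to_nat_inv /fin_of_ord /=.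
by apply: Fin.of_nat_ext.
Qed.

Lemma fin_of_ordK n : cancel (@fin_of_ord n) (@ord_of_fin n).
Proof. by move=> i; apply: val_inj; rewrite /= /fin_of_ord Fin.to_nat_of_nat. Qed.

Definition theory (H : HeytingAlgebra) : variety :=
  fun e => forall v : nat -> H, eval H v e.1 = eval H v e.2.

Lemma in_variety_theory (H : HeytingAlgebra) : in_variety (theory H) H.
Proof. by move=> e; apply. Qed.

(** Numbering the variables by [nat] turns an identity of [H] in [n] variables into an equation of
    [theory H], so it passes to every member of the variety. *)
Lemma free_equiv_theory (H : HeytingAlgebra) n (t s : term (Fin.t n)) :
  (forall v : Fin.t n -> H, eval H v t = eval H v s) ->
  free_equiv (theory H) n t s.
Proof.
move=> ts A AE v; pose f (x : Fin.t n) := val (ord_of_fin x).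
(* The default [htop A] is harmless: renamed terms only use indices below [n]. *)
pose w k : A := if insub k is Some i then v (fin_of_ord i) else htop A.
have wf x : w (f x) = v x by rewrite /w /f valK ord_of_finK.
rewrite -!(@eval_rename _ _ f A w v) //.
by apply: (AE (rename f t, rename f s)) => u; rewrite /= !(@eval_rename _ _ f H u (u \o f)).
Qed.

Lemma finite_representatives (A : Type) (T : finType) (F : A -> T) :
  exists L : list A, forall a, exists b, List.In b L /\ F a = F b.
Proof.
suff [L HL] : exists L : list A, forall a, F a \in enum T ->
    exists b, List.In b L /\ F a = F b.
  by exists L => a; apply: HL; rewrite mem_enum.
elim: (enum T) => [|x r [L HL]]; first by exists nil.
have [[b Fb]|nx] := EM (exists b, F b = x).
  exists (b :: L) => a; rewrite inE => /predU1P[Fa|/HL[c [cL Fc]]].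
    by exists b; split; [left | rewrite Fa].
  by exists c; split; [right |].
exists L => a; rewrite inE => /predU1P[Fa|/HL //].
by case: nx; exists a.
Qed.

(** * Heyting algebras of upsets of a preorder *)

Section UpsetAlgebra.
Variables (P : Type) (le : P -> P -> Prop).
Hypothesis le_refl : forall w, le w w.
Hypothesis le_trans : forall w u z, le w u -> le u z -> le w z.

Definition upset : Type := {U : P -> Prop | forall w u, le w u -> U w -> U u}.

Lemma upset_ext (U W : upset) : (forall w, sval U w <-> sval W w) -> U = W.
Proof.
case: U W => [U hU] [W hW] /= UW; apply: eq_exist.
by apply/funext => w; apply/propext.
Qed.

Definition up_meet (U W : upset) : upset.
Proof.
by exists (fun w => sval U w /\ sval W w) => w u wu [Uw Ww]; split;
  [exact: (svalP U _ _ wu) | exact: (svalP W _ _ wu)].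
Defined.

Definition up_join (U W : upset) : upset.
Proof.
by exists (fun w => sval U w \/ sval W w) => w u wu [Uw|Ww];
  [left; exact: (svalP U _ _ wu) | right; exact: (svalP W _ _ wu)].
Defined.

Definition up_imp (U W : upset) : upset.
Proof.
exists (fun w => forall u, le w u -> sval U u -> sval W u) => w u wu UW z uz.
exact: UW (le_trans wu uz).
Defined.

Definition up_const (Q : Prop) : upset.
Proof. by exists (fun _ => Q). Defined.

Definition UpsetAlgebra : HeytingAlgebra.
Proof.
refine (@Build_HeytingAlgebra upset up_meet up_join up_imp
  (up_const False) (up_const True) _ _ _ _ _ _ _ _ _ _).
1-9: by move=> *; apply: upset_ext => w /=; tauto.
move=> a b c; split=> abc; apply: upset_ext => w /=; split.
- by case.
- move=> aw; split=> // u wu bu.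
  have : sval (up_meet a b) u by split=> //; exact: (svalP a _ _ wu).
  by rewrite -abc => -[].
- by case.
- move=> [aw bw]; split=> //.
  by move: aw; rewrite -abc => -[_]; apply.
Defined.

End UpsetAlgebra.

(* A map [q] into a finite type whose kernel is a bisimulation reduces
   evaluation of terms to evaluation in one of finitely many Kripke models on
   that type. *)
Section FiniteQuotients.
Variables (P : Type) (le : P -> P -> Prop).
Hypothesis le_refl : forall w, le w w.
Hypothesis le_trans : forall w u z, le w u -> le u z -> le w z.
Let H := UpsetAlgebra le_refl le_trans.
Variables (Y : Type) (B X : finType) (o : Y -> B) (g : B -> Y).
Hypothesis oK : cancel o g.

Definition kripke : finType := ({set X * X} * {set B * X})%type.

Fixpoint kripke_eval (D : kripke) (t : term Y) (x : X) : bool :=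
  match t with
  | tvar y => (o y, x) \in D.2
  | tbot => false
  | ttop => true
  | tmeet s u => kripke_eval D s x && kripke_eval D u x
  | tjoin s u => kripke_eval D s x || kripke_eval D u x
  | timp s u => [forall y, ((x, y) \in D.1) ==> kripke_eval D s y ==> kripke_eval D u y]
  end.

Definition bisimulation_quotient (v : B -> upset le) (q : P -> X) : Prop :=
  (forall w w', q w = q w' -> forall b, sval (v b) w -> sval (v b) w') /\
  (forall w w' u, q w = q w' -> le w u -> exists2 u', le w' u' & q u' = q u).

Definition quotient_model (v : B -> upset le) (q : P -> X) : kripke :=
  ([set p | `[< exists w u, [/\ le w u, q w = p.1 & q u = p.2] >]],
   [set p | `[< exists2 w, q w = p.2 & sval (v p.1) w >]]).

Lemma quotient_modelP v q : bisimulation_quotient v q -> forall t w,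
  kripke_eval (quotient_model v q) t (q w) <->
  sval (eval H (fun y => v (o y)) t) w.
Proof.
move=> [qv qle]; elim=> [y|||s IHs u IHu|s IHs u IHu|s IHs u IHu] w //=.
- rewrite inE; split=> [/asboolP[w' /= /qv]|vw]; first exact.
  by apply/asboolP; exists w.
- by rewrite -IHs -IHu; split=> /andP.
- by rewrite -IHs -IHu; split=> /orP.
- split=> [/forallP su z wz /IHs sz|su].
    apply/IHu; move: (su (q z)); rewrite sz inE implyTb => /implyP; apply.
    by apply/asboolP; exists w, z.
  (* The pair is witnessed only at some [w'] in the class of [w]; the back condition yields a
     matching successor of [w] itself. *)
  apply/forallP => y; apply/implyP; rewrite inE => /asboolP[w' [z [/= w'z qw' qz]]].
  have [z' wz' qz'] := qle _ _ _ qw' w'z.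
  apply/implyP; rewrite -qz -qz' => /IHs sz'; exact/IHu/su.
Qed.

(** All quotients live on the one finite type [X], so the truth table of a term over all Kripke
    models on [X] determines its term function on [H]. *)
Lemma finitely_many_term_functions :
  (forall v : B -> upset le, exists q, bisimulation_quotient v q) ->
  exists L : list (term Y), forall t, exists s, List.In s L /\
    forall v : Y -> H, eval H v t = eval H v s.
Proof.
move=> hq.
have [L HL] := finite_representatives
  (fun t => [ffun p : kripke * X => kripke_eval p.1 t p.2]).
exists L => t; have [s [sL ts]] := HL t; exists s; split=> // v.
have [q qP] := hq (v \o g).
have ev r : eval H v r = eval H (fun y => (v \o g) (o y)) r.
  by congr eval; apply/funext => y /=; rewrite oK.
apply: upset_ext => w; rewrite !ev -!(quotient_modelP qP).
by move/ffunP: ts => /(_ (quotient_model (v \o g) q, q w)); rewrite !ffunE /= => ->.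
Qed.

End FiniteQuotients.

(** * The ladder poset *)

Section Ladder.
Variables (I : finType) (s : nat -> I).

Definition ladder : Type := (nat * I)%type.

(** Levels are numbered downwards: [i] is a column of level [l.+1], [j] one of level [l] just above
    it. *)
Definition link (l : nat) (i j : I) : bool := (j != i) || (i == s l.+1).

Definition ladder_le (w u : ladder) : Prop :=
  [|| w == u, u.1.+1 < w.1 | (w.1 == u.1.+1) && link u.1 w.2 u.2].

Lemma ladder_le_refl w : ladder_le w w.
Proof. by rewrite /ladder_le eqxx. Qed.

Lemma ladder_leP w u : ladder_le w u ->
  [\/ u = w, u.1.+1 < w.1 | w.1 = u.1.+1 /\ link u.1 w.2 u.2].
Proof. by case/or3P=> [/eqP->|h|/andP[/eqP h1 h2]]; [apply: Or31|apply: Or32|apply: Or33]. Qed.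

Lemma ladder_le_far (w u : ladder) : u.1.+1 < w.1 -> ladder_le w u.
Proof. by move=> h; rewrite /ladder_le h orbT. Qed.

Lemma ladder_le_link k i j : link k i j -> ladder_le (k.+1, i) (k, j).
Proof. by move=> h; rewrite /ladder_le /= eqxx h !orbT. Qed.

(** Two proper steps climb at least two levels, and at that distance all points are related. *)
Lemma ladder_le_trans w u z : ladder_le w u -> ladder_le u z -> ladder_le w z.
Proof.
move=> wu0 uz; case/ladder_leP: (wu0) uz => [->//|wu|[wu _]] uz.
  by apply: ladder_le_far; case/ladder_leP: uz => [->|uz|[uz _]]; lia.
case/ladder_leP: uz wu => [->|uz|[uz _]] wu.
- exact: wu0.
- by apply: ladder_le_far; lia.
- by apply: ladder_le_far; lia.
Qed.

Definition LadderAlgebra := UpsetAlgebra ladder_le_refl ladder_le_trans.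

Hypothesis s_step : forall k, s k.+1 != s k.

(** * Definable levels *)

Section Definable.
Variables (Y : Type) (v : Y -> LadderAlgebra).

Definition definable (U : ladder -> Prop) : Prop :=
  exists t, forall w, sval (eval LadderAlgebra v t) w <-> U w.

Lemma definable_ext U W : (forall w, U w <-> W w) -> definable U -> definable W.
Proof. by move=> UW [t tU]; exists t => w; rewrite tU. Qed.

Lemma definable_var y : definable (sval (v y)).
Proof. by exists (tvar y). Qed.

Lemma definable_bot : definable (fun _ => False).
Proof. by exists tbot. Qed.

Lemma definable_or U W : definable U -> definable W -> definable (fun w => U w \/ W w).
Proof. by move=> [t tU] [r rW]; exists (tjoin t r) => w /=; rewrite tU rW. Qed.

Lemma definable_imp U W : definable U -> definable W ->
  definable (fun w => forall u, ladder_le w u -> U u -> W u).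
Proof.
move=> [t tU] [r rW]; exists (timp t r) => w /=.
by split=> h u /h; rewrite tU rW.
Qed.

Lemma definable_forall (J : finType) (C : pred J) U :
  (forall j, C j -> definable (U j)) -> definable (fun w => forall j, C j -> U j w).
Proof.
move=> dU; suff : definable (fun w => forall j, j \in enum J -> C j -> U j w).
  by apply: definable_ext => w; split=> h j; [apply: h; rewrite mem_enum | move=> _; apply: h].
elim: (enum J) => [|j r [t tr]]; first by exists ttop.
have [Cj|nCj] := boolP (C j).
  have [t' tj] := dU _ Cj; exists (tmeet t' t) => w /=; rewrite tj tr.
  split=> [[Uj Ur] i /predU1P[->|]//|h]; first exact: Ur.
  by split=> [|i ir]; apply: h; rewrite // inE ?eqxx ?ir ?orbT.
exists t => w; rewrite tr; split=> h i; last by move=> ir; apply: h; rewrite inE ir orbT.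
by case/predU1P=> [->|]; [rewrite (negbTE nCj) | apply: h].
Qed.

Lemma definable_exists (J : finType) U :
  (forall j : J, definable (U j)) -> definable (fun w => exists j, U j w).
Proof.
move=> dU; suff : definable (fun w => exists2 j, j \in enum J & U j w).
  by apply: definable_ext => w; split=> [[j _ Uj]|[j Uj]]; exists j; rewrite ?mem_enum.
elim: (enum J) => [|j r [t tr]]; first by exists tbot => w; split=> [[]|[]].
have [t' tj] := dU j; exists (tjoin t' t) => w /=; rewrite tj tr; split.
  by case=> [Uj|[i ir Ui]]; [exists j; rewrite // inE eqxx | exists i; rewrite // inE ir orbT].
by case=> i /predU1P[->|ir] Ui; [left | right; exists i].
Qed.

Definition above (k : nat) (w : ladder) : Prop := w.1 < k.
Definition above_with (k : nat) (i : I) (w : ladder) : Prop := w.1 < k \/ w = (k, i).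

(** [(k, i)] is the only point of [above_with k i] outside [above k], so this implication is the
    complement of its principal downset. *)
Lemma above_with_imp k i w :
  (forall u, ladder_le w u -> above_with k i u -> above k u) <-> ~ ladder_le w (k, i).
Proof.
split=> [h wi|wi u wu [//|ui]]; last by case: wi; rewrite -ui.
by have /= := h _ wi (or_intror erefl); rewrite /above /= ltnn.
Qed.

Lemma definable_not_below k i : definable (above k) -> definable (above_with k i) ->
  definable (fun w => ~ ladder_le w (k, i)).
Proof.
move=> dk di; apply: definable_ext (definable_imp di dk) => w.
exact: above_with_imp.
Qed.

(** On level [k], only [(k, s k)] lies below none of the other points of that level. *)
Lemma definable_last k : definable (above k) ->
  (forall i, i != s k -> definable (above_with k i)) ->
  definable (above_with k (s k)).
Proof.
move=> dk di.
apply: definable_ext (definable_or dk (definable_forall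
  (fun i ik => definable_not_below dk (di i ik)))) => -[l j]; split.
  case=> [|nle]; first by left.
  have [lk|kl] := ltnP l k; first by left.
  right; move: nle; rewrite leq_eqVlt in kl; case/predU1P: kl => [<-|kl] nle.
    have [->//|jk] := eqVneq j (s k).
    by case: (nle _ jk); exact: ladder_le_refl.
  (* By [s_step], [s k.+1] is one of the other columns, and every point of level [k.+1] sees it on
     level [k]. *)
  case: (nle _ (s_step k)); rewrite leq_eqVlt in kl; case/predU1P: kl => [<-|kl].
    by apply: ladder_le_link; rewrite /link eq_sym orNb.
  exact: ladder_le_far.
case=> [|[-> ->]]; first by left.
right=> i ik /ladder_leP[[/eqP]|/=|[/= /eqP]]; first by rewrite (negbTE ik).
  by rewrite ltnNge leqnSn.
by rewrite ltn_eqF.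
Qed.

(** From level [k.+1] downwards, [(k.+1, i)] alone fails to lie below [(k, i)], its column not being
    special. *)
Lemma definable_next k i : i != s k.+1 -> definable (above k.+1) ->
  definable (above k) -> definable (above_with k i) -> definable (above_with k.+1 i).
Proof.
move=> is1 dk1 dk di.
apply: definable_ext (definable_or dk1 (definable_not_below dk di)) => -[l j]; split.
  case=> [|nle]; first by left.
  have [lk|kl] := ltnP l k.+1; first by left.
  right; move: nle; rewrite leq_eqVlt in kl; case/predU1P: kl => [<-|kl] nle.
    have [<-//|ij] := eqVneq i j.
    by case: nle; apply: ladder_le_link; rewrite /link ij.
  by case: nle; exact: ladder_le_far.
case=> [|[-> ->]]; first by left.
right=> /ladder_leP[[/eqP]|/=|[/= _]]; first by rewrite ltn_eqF.
  by rewrite ltnn.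
by rewrite /link eqxx (negbTE is1).
Qed.

Lemma definable_above : (forall i, i != s 0 -> definable (above_with 0 i)) ->
  forall k, definable (above k).
Proof.
move=> d0.
have step k : (forall i, definable (above_with k i)) -> definable (above k.+1).
  move=> dk; apply: definable_ext (definable_exists dk) => -[l j]; split.
    by move=> [i [/=|[-> _]]]; rewrite /above /= ltnS // => /ltnW.
  rewrite /above /= ltnS leq_eqVlt => /predU1P[->|lk]; exists j; [by right | by left].
suff H k : definable (above k) /\ forall i, definable (above_with k i).
  by move=> k; case: (H k).
elim: k => [|k [dk di]].
  have dk : definable (above 0) by apply: definable_ext definable_bot.
  split=> // i; case: (eqVneq i (s 0)) => [->|/d0 //].
  exact: definable_last.
have dk1 := step _ di; split=> // i.
have dn j : j != s k.+1 -> definable (above_with k.+1 j) by move=> /definable_next; apply.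
by case: (eqVneq i (s k.+1)) => [->|/dn //]; exact: definable_last.
Qed.

End Definable.

(** The terms defining the sets [above k] take pairwise distinct values at [v], more than a finite
    list of terms can produce. *)
Lemma infinite_of_definable_above n (v : Fin.t n -> LadderAlgebra) :
  (forall k, definable v (above k)) -> ~ free_algebra_finite (theory LadderAlgebra) n.
Proof.
move=> dv [L HL]; have [t tP] := choice dv.
pose f k := eval LadderAlgebra v (t k).
have f_inj : FinFun.Injective f.
  move=> k l fkl; have E m : m < k <-> m < l.
    by rewrite -/(above k (m, s 0)) -/(above l (m, s 0)) -!tP -/(f k) fkl.
  by apply/eqP; rewrite eqn_leq leqNgt [l <= k]leqNgt; apply/andP; split;
    apply/negP => /E; rewrite ltnn.
have := List.NoDup_incl_length
  (FinFun.Injective_map_NoDup f_inj (List.seq_NoDup (List.length L).+1 0))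
  (l' := List.map (eval LadderAlgebra v) L).
rewrite !List.length_map List.length_seq => le_len.
have /le_len/leP : List.incl (List.map f (List.seq 0 (List.length L).+1)) (List.map (eval LadderAlgebra v) L).
  move=> _ /List.in_map_iff[k [<- _]]; have [r [rL tr]] := HL (t k).
  by rewrite /f (tr _ (@in_variety_theory _)); exact: List.in_map.
by rewrite ltnn.
Qed.

End Ladder.

(** * Collapse of the ladder under few colours *)

Section Collapse.
Variables (I : finType) (s : nat -> I) (M : nat).
Hypothesis s_cover : forall a i, exists k, [/\ a <= k, k < a + M & s k = i].
Variables (B : finType) (v : B -> upset (ladder_le s)).
Hypothesis few_colours : 2 ^ #|B| < #|I|.

Definition holds (b : B) (k : nat) (i : I) : bool := `[< sval (v b) (k, i) >].

Definition same_colour k i j : bool := [forall b, holds b k i == holds b k j].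

Definition full b k : bool := [forall i, holds b k i].

Definition cut k : {set B} := [set b | ~~ full b k].

Lemma holds_le b k i l j : ladder_le s (k, i) (l, j) -> holds b k i -> holds b l j.
Proof. by move=> le /asboolP h; apply/asboolP; exact: (svalP (v b) _ _ le). Qed.

(** The special column sees the whole level above, so fullness propagates upwards. *)
Lemma cut_mono k l : k <= l -> cut k \subset cut l.
Proof.
move=> kl; apply/subsetP => b; rewrite !inE; apply: contra => /forallP fl.
apply/forallP => i; rewrite leq_eqVlt in kl; case/predU1P: kl => [->//|kl].
apply: holds_le (fl (s k.+1)); rewrite leq_eqVlt in kl; case/predU1P: kl => [<-|kl].
  by apply: ladder_le_link; rewrite /link eqxx orbT.
exact: ladder_le_far.
Qed.

Lemma holds_full b k i : b \notin cut k -> holds b k i.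
Proof. by rewrite inE negbK => /forallP. Qed.

Lemma holds_empty b k l i : b \in cut k -> k.+1 < l -> holds b l i = false.
Proof.
rewrite inE => /forallPn[j nj] kl; apply: contraNF nj; apply: holds_le.
exact: ladder_le_far.
Qed.

(** A bisimulation within levels, by recursion from the top. A point misses at most its own column
    on the level above, hence misses no class if its column is special or has another column
    equivalent to it there. *)
Fixpoint equiv k i j : bool :=
  if k is l.+1 then
    (i == j) || [&& same_colour k i j,
      (i == s k) || [exists x, (x != i) && equiv l i x] &
      (j == s k) || [exists x, (x != j) && equiv l j x]]
  else same_colour k i j.

(* The points whose neighbourhood on the level above meets every class. *)
Definition sees_all_classes k i : bool :=
  (i == s k.+1) || [exists x, (x != i) && equiv k i x].

Lemma equivS k i j : equiv k.+1 i j =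
  (i == j) || [&& same_colour k.+1 i j, sees_all_classes k i & sees_all_classes k j].
Proof. by []. Qed.

Lemma same_colour_refl k i : same_colour k i i.
Proof. by apply/forallP => b. Qed.

Lemma same_colour_sym k i j : same_colour k i j = same_colour k j i.
Proof. by apply: eq_forallb => b; rewrite eq_sym. Qed.

Lemma same_colour_trans k i j x : same_colour k i j -> same_colour k j x -> same_colour k i x.
Proof.
by move=> /forallP ij /forallP jx; apply/forallP => b; rewrite (eqP (ij b)).
Qed.

Lemma equiv_refl k i : equiv k i i.
Proof. by case: k => [|k]; rewrite ?equivS ?eqxx //; exact: same_colour_refl. Qed.

Lemma equiv_sym k i j : equiv k i j = equiv k j i.
Proof.
case: k => [|k]; first exact: same_colour_sym.
by rewrite !equivS eq_sym same_colour_sym [sees_all_classes k i && _]andbC.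
Qed.

Lemma equiv_trans k i j x : equiv k i j -> equiv k j x -> equiv k i x.
Proof.
case: k => [|k]; first exact: same_colour_trans.
rewrite !equivS => /predU1P[->//|/and3P[ij ai aj]] /predU1P[<-|/and3P[jx _ ax]].
  by rewrite ij ai aj orbT.
by rewrite (same_colour_trans ij jx) ai ax orbT.
Qed.

Lemma equiv_same_colour k i j : equiv k i j -> same_colour k i j.
Proof.
case: k => [//|k]; rewrite equivS => /predU1P[->|/and3P[]//].
exact: same_colour_refl.
Qed.

Lemma sees_all_classesP k i : sees_all_classes k i ->
  forall x, exists2 y, link s k i y & equiv k x y.
Proof.
move=> ai x; case: (eqVneq x i) => [->|xi]; last first.
  by exists x; rewrite ?equiv_refl // /link xi.
case/orP: ai => [is1|/existsP[y /andP[yi iy]]].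
  by exists i; rewrite ?equiv_refl // /link is1 orbT.
by exists y; rewrite // /link yi.
Qed.

Lemma equiv_sees_all k i j : i != j -> equiv k.+1 i j -> sees_all_classes k i.
Proof. by rewrite equivS => /negbTE-> /and3P[]. Qed.

Lemma sees_all_of_equiv k i j : i != j -> equiv k i j -> sees_all_classes k i.
Proof.
move=> ij eij; apply/orP; right; apply/existsP; exists j.
by rewrite eq_sym ij.
Qed.

(* [sig i] records, for each [b], the value of [b] in column [i] of the first
   level where [b] is not full. *)
Lemma inseparable_pair : exists i j, i != j /\ forall k, equiv k i j.
Proof.
pose sig i : {ffun B -> bool} :=
  [ffun b => `[< forall k, (forall l, l < k -> full b l) -> holds b k i >]].
have /injectivePn[i [j ij sij]] : ~~ injectiveb sig.
  apply/injectiveP => /leq_card; rewrite card_ffun card_bool leqNgt.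
  by rewrite few_colours.
exists i, j; split=> //.
have first_cut b k x : (forall l, l < k -> full b l) -> ~~ full b k ->
    sig x b = holds b k x.
  move=> fk nk; rewrite ffunE; apply/asboolP/idP => [|hk l fl]; first exact.
  have [lk|kl|->//] := ltngtP l k; first by move/forallP: (fk _ lk).
  by rewrite fl in nk.
elim=> [|k IH].
  apply/forallP => b; have [/forallP f0|nf0] := boolP (full b 0); first by rewrite !f0.
  by rewrite -!first_cut ?sij.
have ai := sees_all_of_equiv ij IH.
have aj : sees_all_classes k j by apply: (@sees_all_of_equiv _ _ i); rewrite 1?eq_sym // equiv_sym.
rewrite equivS; apply/predU1P; right; apply/and3P; split=> //.
apply/forallP => b.
have [/forallP f1|nf1] := boolP (full b k.+1); first by rewrite !f1.
(* If [b] is full up to level [k], then [k.+1] is its first cut level and [sig] decides; otherwise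
   [i] and [j] both see the class of a point where [b] fails, so [b] fails at both. *)
have [bk|bk] := boolP (b \in cut k); last first.
  rewrite -!first_cut ?sij // => l; rewrite ltnS => lk;
  by have := contra (subsetP (cut_mono lk) b) bk; rewrite inE negbK.
have empty x : sees_all_classes k x -> holds b k.+1 x = false.
  move=> /sees_all_classesP ax; move: bk; rewrite inE => /forallPn[y ny].
  have [z xz /equiv_same_colour/forallP/(_ b)/eqP yz] := ax y.
  by apply: contraNF ny; rewrite yz; apply: holds_le; exact: ladder_le_link.
by rewrite !empty.
Qed.

(* All levels from [k - M] to [k] have the same constant colour. *)
Definition stable k : bool := (M.+2 <= k) && (cut (k - M.+2) == cut k).

(** The two extra levels in [stable] ensure that a colour not full on level [k - M.+2] is empty from
    [k - M] on. *)
Lemma stable_colour k b i : stable k -> holds b k i = (b \notin cut k).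
Proof.
move=> /andP[Mk /eqP ck]; have [bk|bk] := boolP (b \in cut k); last exact: holds_full.
by apply: (@holds_empty _ (k - M.+2)); rewrite ?ck //; lia.
Qed.

(* From level [k - M] to level [k] colours are constant, and passing from level [l]
   to [l.+1] the class of the inseparable pair absorbs the column [s l.+1]. *)
Lemma stable_equiv k i j : stable k -> equiv k i j.
Proof.
move=> /andP[Mk /eqP ck]; pose a := k - M.
have [x [y [xy exy]]] := inseparable_pair.
have colour l i' j' : a <= l <= k -> same_colour l i' j'.
  move=> /andP[al lk]; apply/forallP => b.
  have [bk|bk] := boolP (b \in cut k).
    have la : (k - M.+2).+1 < l by rewrite /a in al; lia.
    by rewrite !(@holds_empty b (k - M.+2) l) // ck.
  by rewrite !holds_full //; apply: contra bk; apply/subsetP/cut_mono.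
pose absorbed l z := [\/ z = x, z = y | exists r, [/\ a <= r, r < l & z = s r.+1]].
have absorb l : a <= l <= k -> forall i' j', absorbed l i' -> absorbed l j' -> equiv l i' j'.
  elim: l => [|l IH] /andP[al lk] i' j' hi hj.
    by apply: colour; rewrite al.
  (* On the first level [a] only the inseparable pair has been absorbed. *)
  case: (eqVneq a l.+1) => [al1|al1].
    have pair z : absorbed l.+1 z -> z = x \/ z = y.
      by case; [left | right | case=> r [ar rl _]; move: rl; rewrite -al1 ltnNge ar].
    case: (pair _ hi) => ->; case: (pair _ hj) => ->; rewrite ?equiv_refl //.
    by rewrite equiv_sym.
  have {}al : a <= l <= k by lia.
  have all z : absorbed l.+1 z -> sees_all_classes l z.
    have old w : absorbed l w -> sees_all_classes l w.
      move=> hw; case: (eqVneq w x) => [->|wx]; first exact: sees_all_of_equiv xy _.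
      by apply: sees_all_of_equiv wx _; apply: IH => //; apply: Or31.
    case=> [zx|zy|[r [ar rl zr]]]; [apply: old; exact: Or31 | apply: old; exact: Or32 |].
    move: rl; rewrite ltnS leq_eqVlt => /predU1P[rl|rl].
      by rewrite /sees_all_classes zr rl eqxx.
    by apply: old; apply: Or33; exists r.
  by rewrite equivS (colour l.+1) ?all ?orbT //; lia.
have ak : a <= k <= k by rewrite /a; lia.
suff all z : absorbed k z by apply: absorb.
(* Levels [a.+1] to [a + M = k] form a window of length [M], in which every column is special at
   least once. *)
have [[|r] [ar rM sr]] := s_cover a.+1 z; first by [].
by apply: Or33; exists r; rewrite -sr; split=> //; rewrite /a in ar rM *; lia.
Qed.

(** Level [k.+1] is one class with at least two columns, and distinct equivalent columns see all
    classes above. *)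
Lemma stable_sees_all k i : stable k.+1 -> sees_all_classes k i.
Proof.
move=> st; have [x [y [xy _]]] := inseparable_pair.
have [ix|ix] := eqVneq i x.
  by apply: (@equiv_sees_all _ _ y); rewrite ?ix //; exact: stable_equiv.
by apply: equiv_sees_all ix _; exact: stable_equiv.
Qed.

Lemma stable_between k l r : k <= l -> l <= r -> stable k -> cut k = cut r ->
  cut l = cut r /\ stable l.
Proof.
move=> kl lr /andP[Mk /eqP ck] ckr.
have clr : cut l = cut r.
  by apply/eqP; rewrite eqEsubset cut_mono // -ckr cut_mono.
split=> //; apply/andP; split; first exact: leq_trans kl.
rewrite clr eqEsubset -{1}clr cut_mono ?leq_subr // -ckr -ck cut_mono //.
exact: leq_sub2r.
Qed.

(** Equal residues put the levels at least [M.+2] apart, which squeezes the cut at [l - M.+2]. *)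
Lemma stable_of_mod k l : k < l -> cut k = cut l -> k = l %[mod M.+2] -> stable l.
Proof.
move=> kl ckl mkl; have d : M.+2 %| l - k by rewrite -eqn_mod_dvd ?(ltnW kl) // mkl.
have dl : M.+2 <= l - k by apply: dvdn_leq => //; rewrite subn_gt0.
apply/andP; split; first by lia.
by rewrite eqEsubset cut_mono ?leq_subr // -ckl cut_mono //; lia.
Qed.

(* Unstable levels with the same [cut] lie in a window of length [M.+2], so the
   residue modulo [M.+2] separates them. *)
Definition collapse (w : ladder I) : {set B} * option 'I_M.+2 * {set I} :=
  (cut w.1, if stable w.1 then None else Some (inord (w.1 %% M.+2)),
   [set j | equiv w.1 w.2 j]).

Lemma collapseP k i l j : collapse (k, i) = collapse (l, j) ->
  (k = l /\ equiv k i j) \/ [/\ stable k, stable l & cut k = cut l].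
Proof.
case=> ckl; have [sk|nsk] := boolP (stable k); have [sl|nsl] := boolP (stable l) => //.
  by right.
case=> /(congr1 val); rewrite /= !inordK ?ltn_pmod // => mkl eij; left.
have kl : k = l.
  have [lt|lt|//] := ltngtP k l.
    by rewrite (stable_of_mod lt) in nsl.
  by rewrite (stable_of_mod lt) in nsk.
split=> //; rewrite -kl in eij; move/setP: eij => /(_ j).
by rewrite !inE equiv_refl.
Qed.

Lemma collapse_equiv k i j : equiv k i j -> collapse (k, i) = collapse (k, j).
Proof.
move=> eij; congr (_, _); apply/setP => x; rewrite !inE.
by apply/idP/idP; apply: equiv_trans; rewrite // equiv_sym.
Qed.

Lemma collapse_stable k i l j : stable k -> stable l -> cut k = cut l ->
  collapse (k, i) = collapse (l, j).
Proof.
move=> sk sl ckl; rewrite /collapse /= sk sl ckl; congr (_, _).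
by apply/setP => x; rewrite !inE !stable_equiv.
Qed.

Lemma collapse_quotient : bisimulation_quotient v collapse.
Proof.
split=> [[k i] [l j] /collapseP kl b|[k i] [l j] [r x] /collapseP kl].
  move=> /asboolP hb; apply/asboolP; rewrite -/(holds b k i) in hb.
  rewrite -/(holds b l j).
  case: kl => [[<- /equiv_same_colour/forallP/(_ b)/eqP <-//]|[sk sl ckl]].
  by rewrite stable_colour // -ckl -(stable_colour b i sk).
case: kl => [[<- eij]|[sk sl ckl]] /ladder_leP /=.
  case=> [[-> ->]|kr|[kr ix]].
  - by exists (k, j); [exact: ladder_le_refl | exact/esym/collapse_equiv].
  - by exists (r, x) => //; exact: ladder_le_far.
  have [ij|ij] := eqVneq i j.
    by exists (r, x) => //; rewrite -ij kr; exact: ladder_le_link.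
  rewrite kr in eij *; rewrite eq_sym in ij.
  have /sees_all_classesP/(_ x)[y jy xy] : sees_all_classes r j.
    by apply: equiv_sees_all ij _; rewrite equiv_sym.
  by exists (r, y); [exact: ladder_le_link | exact/esym/collapse_equiv].
move=> kr; have rk : r <= k by case: kr => [[-> _]|/ltnW/ltnW|[->]].
(* If level [r] lies at or below level [l], it is stable with the same cut, so [(l, j)] itself
   serves as the successor. *)
have [lr|rl] := leqP l r.
  exists (l, j); first exact: ladder_le_refl.
  have [crk sr] := stable_between lr rk sl (esym ckl).
  by apply: collapse_stable; rewrite // crk.
rewrite leq_eqVlt in rl; case/predU1P: rl => [rl|rl].
  rewrite -rl in sl *.
  have /sees_all_classesP/(_ x)[y jy xy] := stable_sees_all j sl.
  by exists (r, y); [exact: ladder_le_link | exact/esym/collapse_equiv].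
by exists (r, x) => //; exact: ladder_le_far.
Qed.

End Collapse.

(** * Cyclic schedule of the special columns *)

Section CyclicSchedule.
Variable I : finType.
Hypothesis I_gt1 : 1 < #|I|.

Definition cycle_through (x : I) (k : nat) : I := nth x (enum I) (k %% #|I|).

Lemma cycle_through_step x k : cycle_through x k.+1 != cycle_through x k.
Proof.
have I_gt0 : 0 < #|I| by exact: ltnW.
rewrite /cycle_through nth_uniq -?cardE ?ltn_pmod ?enum_uniq //.
by rewrite -addn1 -{2}[k]addn0 eqn_modDl mod0n modn_small.
Qed.

Lemma cycle_through_cover x a i :
  exists k, [/\ a <= k, k < a + #|I| & cycle_through x k = i].
Proof.
have I_gt0 : 0 < #|I| by exact: ltnW.
have ilt : index i (enum I) < #|I| by rewrite cardE index_mem mem_enum.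
(* The offset is [index i (enum I) - a] modulo [#|I|], arranged to avoid truncated subtraction. *)
exists (a + (index i (enum I) + (#|I| - a %% #|I|)) %% #|I|); split.
- exact: leq_addr.
- by rewrite ltn_add2l ltn_pmod.
rewrite /cycle_through modnDmr -modnDml addnCA subnKC; last exact/ltnW/ltn_pmod.
by rewrite modnDr modn_small // nth_index // mem_enum.
Qed.

End CyclicSchedule.

(** * Telling the points of level 0 apart, one colour per bit *)

Section Colouring.
Variable n : nat.
Let I : finType := {ffun 'I_n -> bool}.
Variable s : nat -> I.

(** Bits are compared with those of [s 0], so that every other column of level 0 lies in at least
    one of these upsets. *)
Definition bit_upset (y : Fin.t n) : upset (ladder_le s).
Proof.
exists (fun w : ladder I => w.1 = 0 /\ w.2 (ord_of_fin y) != s 0 (ord_of_fin y)).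
by move=> [k i] [l j] /ladder_leP /= [[-> ->]//|kl|[kl _]] [k0]; rewrite k0 in kl.
Defined.

(** Points of level 0 are maximal, so there the pseudocomplement is the complement; a bit where [i]
    differs from [s 0] excludes all lower levels. *)
Lemma definable_bits i : i != s 0 ->
  definable (bit_upset : _ -> LadderAlgebra s) (above_with 0 i).
Proof.
move=> is0; have [b ib] : exists b, i b != s 0 b.
  apply/forallPn; apply: contra is0 => /forallP e.
  by apply/eqP/ffunP => b; apply/eqP.
pose V : Fin.t n -> LadderAlgebra s := bit_upset.
pose U c w := if i c != s 0 c then sval (V (fin_of_ord c)) w
  else forall u, ladder_le s w u -> sval (V (fin_of_ord c)) u -> False.
have dU c : definable V (U c).
  rewrite /U; case: (i c != s 0 c); first exact: definable_var.
  exact: definable_imp (definable_var _ _) (definable_bot V).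
apply: definable_ext (definable_forall (C := predT) (fun c _ => dU c)) => -[k j].
split=> [h|[//|[-> ->]] c _]; last first.
  rewrite /U /= fin_of_ordK; case: ifP => // ic.
  by move=> u /ladder_leP[->|//|[//]] /= [_]; rewrite ?fin_of_ordK ic.
have k0 : k = 0 by have := h b isT; rewrite /U ib => -[].
right; rewrite k0; congr (_, _); apply/ffunP => c; have := h c isT.
rewrite /U; case: (boolP (i c != s 0 c)) => [ic [_]|/negPn/eqP -> hc].
  by rewrite /= fin_of_ordK; case: (j c) (i c) (s 0 c) ic => -[] [].
apply/eqP/negPn/negP => jc; apply: (hc (k, j) (ladder_le_refl s _)).
by rewrite /= fin_of_ordK.
Qed.

End Colouring.

Theorem mainTheorem1 : forall n : nat,
  exists V : variety,
    free_algebra_finite V n /\ ~ free_algebra_finite V (S n).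
Proof.
move=> n; pose I : finType := {ffun 'I_n.+1 -> bool}.
have cardI : #|I| = 2 ^ n.+1 by rewrite card_ffun card_bool card_ord.
have I_gt1 : 1 < #|I| by rewrite cardI -{1}(expn0 2) ltn_exp2l.
pose s := cycle_through ([ffun _ => false] : I).
exists (theory (LadderAlgebra s)); split; last first.
  apply: (@infinite_of_definable_above _ s _ (@bit_upset _ s)) => k.
  apply: definable_above; first exact: cycle_through_step.
  exact: definable_bits.
have [|L HL] := finitely_many_term_functions (@ladder_le_refl _ s) (@ladder_le_trans _ s)
  (X := ({set 'I_n} * option 'I_(#|I|.+2) * {set I})%type) (@ord_of_finK n).
  (* [M] is the period [#|I|] of the schedule; the bound on colours becomes [2 ^ n < 2 ^ n.+1]. *)
  move=> v; exists (collapse #|I| v); apply: collapse_quotient.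
  - exact: cycle_through_cover.
  - by rewrite cardI card_ord ltn_exp2l.
exists L => t; have [r [rL tr]] := HL t; exists r; split=> //.
exact: free_equiv_theory.
Qed.
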